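(* Let $\mathbb{K}$ be an algebraically closed field of characteristic zero, and let $X=\{T_0^{l_0}+T_1^{l_1}+T_2^{l_2}=0\}\subseteq\mathbb{K}^n$ be a trinomial hypersurface such that $n_il_{i1}>1$ for $i=0,1,2$. Assume that $X$ is factorial. Then $X$ is rigid if and only if every exponent in the trinomial $T_0^{l_0}+T_1^{l_1}+T_2^{l_2}$ is at least $2$, i.e. $l_{ij}\ge 2$ for all $i=0,1,2$ and $j=1,\ldots,n_i$.
   Context: Trinomial hypersurfaces: fix positive integers $n_0,n_1,n_2$ and let $n=n_0+n_1+n_2$. For each $i=0,1,2$ fix a tuple $l_i=(l_{i1},\ldots,l_{in_i})\in\mathbb{Z}_{>0}^{n_i}$ and define the monomial $T_i^{l_i}:=T_{i1}^{l_{i1}}\cdots T_{in_i}^{l_{in_i}}$ in the polynomial ring $\mathbb{K}[T_{ij};\ i=0,1,2,\ j=1,\ldots,n_i]$ in $n$ variables. A trinomial is a polynomial of the form $f=T_0^{l_0}+T_1^{l_1}+T_2^{l_2}$, and the trinomial hypersurface $X$ is the zero set $\{f=0\}$ in the affine space $\mathbb{K}^n$. It is an irreducible normal affine variety of dimension $n-1$, with algebra of regular functions $\mathbb{K}[X]=\mathbb{K}[T_{ij}]/(f)$. The condition $n_il_{i1}>1$ for $i=0,1,2$ means that $f$ contains no linear term. An affine variety $X$ is factorial if $\mathbb{K}[X]$ is a unique factorization domain. A derivation of a $\mathbb{K}$-algebra $A$ is a $\mathbb{K}$-linear map $D\colon A\to A$ with $D(ab)=D(a)b+aD(b)$ for all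 $a,b\in A$; it is locally nilpotent if for each $a\in A$ there exists $m\in\mathbb{Z}_{>0}$ with $D^m(a)=0$. An affine variety $X$ is rigid if $\mathbb{K}[X]$ admits no nonzero locally nilpotent derivation. *)

(* Defs.v *)
From HB Require Import structures.
From mathcomp Require Import all_boot all_order all_algebra.
From mathcomp Require Import generic_quotient ring_quotient.
From mathcomp Require Import boolp.
From mathcomp Require Import mpoly.

Set Implicit Arguments.
Unset Strict Implicit.
Unset Printing Implicit Defensive.

Import GRing.Theory.

Local Open Scope ring_scope.
Local Open Scope quotient_scope.

Section PrincipalQuotient.
Variables (K : comNzRingType) (A : comAlgType K) (f : A).
(* [ideal_quot] only covers proper ideals, hence this argument. *)
Hypothesis f_nonunit : ~ exists g, g * f = 1.

Definition principal_ideal (_ : ~ exists g, g * f = 1) : {pred A} :=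
  fun a => `[< exists g, a = g * f >].

Lemma principal_idealr_closed : idealr_closed (principal_ideal f_nonunit).
Proof.
split.
- by apply/asboolP; exists 0; rewrite mul0r.
- by apply/negP => /asboolP[g g1]; apply: f_nonunit; exists g.
- move=> a u v /asboolP[g ->] /asboolP[h ->]; apply/asboolP.
  by exists (a * g + h); rewrite mulrDl mulrA.
Qed.

HB.instance Definition _ :=
  isIdealr.Build A (principal_ideal f_nonunit) principal_idealr_closed.

Definition principal_quot : Type := {ideal_quot (principal_ideal f_nonunit)}.

HB.instance Definition _ := GRing.ComNzRing.on principal_quot.

Definition principal_pi (a : A) : principal_quot :=
  \pi_({ideal_quot (principal_ideal f_nonunit)}) a.

Lemma principal_pi_zmod : zmod_morphism principal_pi.
Proof. by move=> a b; rewrite /principal_pi rmorphB. Qed.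
Lemma principal_pi_monoid : monoid_morphism principal_pi.
Proof. by split=> [|a b]; rewrite /principal_pi ?rmorph1 ?rmorphM. Qed.
HB.instance Definition _ :=
  GRing.isZmodMorphism.Build A principal_quot principal_pi principal_pi_zmod.
HB.instance Definition _ :=
  GRing.isMonoidMorphism.Build A principal_quot principal_pi
    principal_pi_monoid.

Definition principal_scale (c : K) (x : principal_quot) : principal_quot :=
  principal_pi c%:A * x.

Lemma principal_scaleA a b x :
  principal_scale a (principal_scale b x) = principal_scale (a * b) x.
Proof.
by rewrite /principal_scale mulrA -rmorphM -scalerAl mul1r scalerA.
Qed.
Lemma principal_scale1 : left_id 1 principal_scale.
Proof. by move=> x; rewrite /principal_scale scale1r rmorph1 mul1r. Qed.
Lemma principal_scaleDr : right_distributive principal_scale +%R.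
Proof. by move=> a x y; rewrite /principal_scale mulrDr. Qed.
Lemma principal_scaleDl x : {morph principal_scale^~ x : a b / a + b}.
Proof. by move=> a b; rewrite /principal_scale scalerDl rmorphD mulrDl. Qed.
HB.instance Definition _ := GRing.Zmodule_isLmodule.Build K principal_quot
  principal_scaleA principal_scale1 principal_scaleDr principal_scaleDl.

Lemma principal_scaleAl (c : K) (x y : principal_quot) :
  c *: (x * y) = (c *: x) * y.
Proof. exact: mulrA. Qed.
HB.instance Definition _ :=
  GRing.Lmodule_isLalgebra.Build K principal_quot principal_scaleAl.
HB.instance Definition _ :=
  GRing.Lalgebra_isComAlgebra.Build K principal_quot.

Definition principal_unit : {pred principal_quot} :=
  fun x => `[< exists y, y * x = 1 >].

Definition principal_inv (x : principal_quot) : principal_quot :=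
  if pselect (exists y, y * x = 1) is left ex then projT1 (cid ex) else x.

Lemma principal_mulVx : {in principal_unit, left_inverse 1 principal_inv *%R}.
Proof.
move=> x /asboolP ux; rewrite /principal_inv.
by case: pselect => // ex; case: (cid ex).
Qed.
Lemma principal_unitPl x y : y * x = 1 -> principal_unit x.
Proof. by move=> yx1; apply/asboolP; exists y. Qed.
Lemma principal_inv_out : {in [predC principal_unit], principal_inv =1 id}.
Proof.
move=> x /negP nux; rewrite /principal_inv.
by case: pselect => // ex; case: nux; apply/asboolP.
Qed.
HB.instance Definition _ := GRing.ComNzRing_hasMulInverse.Build principal_quot
  principal_mulVx principal_unitPl principal_inv_out.

End PrincipalQuotient.

Section UFD.
Variable R : comUnitRingType.

Definition irreducible_elt (p : R) : Prop :=
  [/\ p != 0, p \isn't a GRing.unit &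
      forall a b, p = a * b -> a \is a GRing.unit \/ b \is a GRing.unit].

Definition associated (a b : R) : Prop :=
  exists2 u, u \is a GRing.unit & b = u * a.

Definition factors_into_irreducibles : Prop :=
  forall x : R, x != 0 -> x \isn't a GRing.unit ->
    exists2 s : seq R, {in s, forall p, irreducible_elt p} &
                       x = \prod_(p <- s) p.

Definition factorization_unique : Prop :=
  forall s t : seq R,
    {in s, forall p, irreducible_elt p} ->
    {in t, forall p, irreducible_elt p} ->
    \prod_(p <- s) p = \prod_(p <- t) p ->
    exists t' : seq R,
      [/\ perm_eq t t', size s = size t' &
          forall i, (i < size s)%N -> associated s`_i t'`_i].

Definition is_ufd : Prop :=
  [/\ GRing.integral_domain_axiom R, factors_into_irreducibles &
      factorization_unique].

End UFD.

Section LND.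
Variables (K : comNzRingType) (A : comAlgType K).

Definition derivation (D : {linear A -> A}) : Prop :=
  forall a b : A, D (a * b) = D a * b + a * D b.

Definition locally_nilpotent (D : A -> A) : Prop :=
  forall a : A, exists2 m, (0 < m)%N & iter m D a = 0.

Definition has_no_nonzero_lnd : Prop :=
  forall D : {linear A -> A},
    derivation D -> locally_nilpotent D -> forall a, D a = 0.

End LND.

Section Trinomial.
Variables (K : fieldType) (n : 'I_3 -> nat) (l : forall i, 'I_(n i) -> nat).

(* [tagnat.Rank i j] numbers the variable T_ij among all the
   n_0 + n_1 + n_2 variables. *)
Definition trinomial : {mpoly K[\sum_(i < 3) n i]} :=
  \sum_(i < 3) \prod_(j < n i) 'X_(tagnat.Rank i j) ^+ l j.

Hypotheses (n_gt0 : forall i, (0 < n i)%N) (l_gt0 : forall i j, (0 < @l i j)%N).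

Lemma trinomial_nonunit : ~ exists g, g * trinomial = 1.
Proof.
case=> g /(congr1 (meval (fun=> 0))); rewrite mevalM meval1.
suff -> : meval (fun=> 0) trinomial = 0.
  by rewrite mulr0 => /eqP; rewrite eq_sym oner_eq0.
rewrite /trinomial rmorph_sum big1 // => i _.
rewrite rmorph_prod (bigD1 (Ordinal (n_gt0 i))) //= rmorphXn /= mevalXU.
by rewrite expr0n eqn0Ngt l_gt0 mul0r.
Qed.

(* K[X] = K[T_ij] / (f) for the trinomial f above *)
Definition coordinate_ring := principal_quot trinomial_nonunit.
HB.instance Definition _ := GRing.ComUnitAlgebra.on coordinate_ring.

Definition factorial_hypersurface : Prop := is_ufd coordinate_ring.

Definition rigid_hypersurface : Prop := @has_no_nonzero_lnd K coordinate_ring.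

End Trinomial.

(* Main.v *)
Require Import Defs.
From HB Require Import structures.
From mathcomp Require Import all_boot all_order all_algebra.
From mathcomp Require Import generic_quotient ring_quotient boolp mpoly.
From mathcomp Require Import zify ring.

(** Write f for the trinomial, A for its coordinate ring, d_i for the gcd of the
    exponents in the block T_i^(l_i), and x, y for variables.

    If the exponent of x is 1, the Hamiltonian derivation
    D = f_y d/dx - f_x d/dy, with y in another block, kills f.
    Here f_x is a monomial involving neither x nor y, so D f_x = 0;
      then D y = - f_x
    makes y nilpotent, and D x = f_y, which does not involve x, makes x
    nilpotent. As f_x does not vanish on X, this locally nilpotent
    derivation is nonzero (not_rigid_of_exponent1).

    Conversely, let all exponents be at least 2 and let A be factorial.

    The variables are irreducible in A (var_irreducible), hence prime, and this
    forces the d_i to be pairwise coprime: if g > 1 divides d_i and d_k, then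
    the sum of the blocks i and k splits into S_i - zeta S_k and a cofactor, but
    it is also minus the third block, whose prime factors divide neither of
    these (block_gcd_coprime).

    Coprimality makes the grading group of f torsion free. So for every variable
    x, of exponent e(x), there is a Z-grading of A for which x has weight 1
    modulo e(x) and all the other variables have weight 0 modulo e(x)
    (modular_weight).

    Suppose that D is a nonzero locally nilpotent derivation. Passing to leading
    components, one grading after another, makes D homogeneous for all
    these gradings (homogenization). Let D x <> 0 and let delta be the degree
    of D in the grading attached to x. A homogeneous element whose weight
    is not 0 modulo e(x) is divisible by x, since x is the only variable whose
    weight is not. Now x does not divide D x, by local nilpotency; so
    1 + delta = 0 modulo e(x). For any other variable y, the weight of D y is
    delta = -1 modulo e(x), which is not 0 because e(x) >= 2; so x divides D y.
    If D y <> 0 as well, then y divides D x by symmetry, and the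
    degree function of D gives deg x > deg y > deg x. Hence D moves only
    one variable x (lnd_single_variable), and 0 = D f = f_x * D x in the domain
    A, where f_x <> 0: a contradiction (rigid_of_factorial). *)

Set Implicit Arguments.
Unset Strict Implicit.
Unset Printing Implicit Defensive.

Import GRing.Theory Order.TTheory Num.Theory.

Local Open Scope ring_scope.

(** * Nilpotency and the degree function of a derivation *)

Section Nilpotency.
Variables (K : fieldType) (A : comAlgType K) (D : {linear A -> A}).
Hypothesis derD : derivation D.

Lemma iter_der0 m : iter m D 0 = 0.
Proof. by elim: m => //= m ->; rewrite linear0. Qed.

Lemma iter_derD m a b : iter m D (a + b) = iter m D a + iter m D b.
Proof. by elim: m => //= m ->; rewrite linearD. Qed.

Lemma iter_der_ge0 m k a : iter m D a = 0 -> (m <= k)%N -> iter k D a = 0.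
Proof. by move=> Da0 /subnK <-; rewrite iterD Da0 iter_der0. Qed.

Lemma der1 : D 1 = 0.
Proof.
have := derD 1 1; rewrite !(mulr1, mul1r) => /eqP.
by rewrite addrC -subr_eq subrr eq_sym => /eqP.
Qed.

Lemma derA (c : K) : D c%:A = 0.
Proof. by rewrite linearZ_LR /= der1 scaler0. Qed.

(** The extreme case of the Leibniz formula: all other terms of
    D^(m+k)(ab) contain D^(m+1) a or D^(k+1) b. *)
Lemma iter_der_mul m k a b :
    iter m.+1 D a = 0 -> iter k.+1 D b = 0 ->
  iter (m + k) D (a * b) = 'C(m + k, m)%:R * (iter m D a * iter k D b).
Proof.
move En: (m + k)%N => n; elim: n m k En a b =>
  [|n IHn] [|m] [|k] //= En a b Da Db.
- by rewrite bin0 mul1r.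
- case: En => En; rewrite -iterS iterSr derD Da mul0r add0r (IHn 0%N k)
  -?iterSr //.
  by rewrite !bin0.
- case: En => En; rewrite addn0 in En;
  rewrite -iterS iterSr derD Db mulr0 addr0.
  by rewrite (IHn m 0%N) -?iterSr ?addn0 // En !binn.
rewrite -iterS iterSr derD iter_derD.
case: En => En; have En' : (m.+1 + k = n)%N by rewrite addSnnS.
rewrite (IHn m k.+1) -?iterSr // (IHn m.+1 k) -?iterSr //.
by rewrite binS natrD mulrDl addrC.
Qed.

Lemma iter_der_mul0 m k a b :
    iter m.+1 D a = 0 -> iter k.+1 D b = 0 -> iter (m + k).+1 D (a * b) = 0.
Proof.
move=> Da Db; rewrite iterS iter_der_mul // mulr_natl linearMn derD.
by rewrite -!iterS Da Db mul0r mulr0 addr0 mul0rn.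
Qed.

Definition der_nilpotent a := exists m, iter m D a = 0.

Lemma der_nilpotentE a m : iter m D a = 0 -> iter m.+1 D a = 0.
Proof. by move=> /iter_der_ge0; apply. Qed.

Lemma der_nilpotentD a b :
  der_nilpotent a -> der_nilpotent b -> der_nilpotent (a + b).
Proof.
move=> [m Da] [k Db]; exists (maxn m k).
by rewrite iter_derD (iter_der_ge0 Da) ?leq_maxl // (iter_der_ge0 Db) ?leq_maxr
  // addr0.
Qed.

Lemma der_nilpotentM a b :
  der_nilpotent a -> der_nilpotent b -> der_nilpotent (a * b).
Proof.
move=> [m Da] [k Db]; exists (m + k).+1.
by apply: iter_der_mul0; apply: der_nilpotentE.
Qed.

Lemma der_nilpotentA (c : K) : der_nilpotent c%:A.
Proof. by exists 1%N; rewrite /= derA. Qed.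

Lemma der_nilpotentX a m : der_nilpotent a -> der_nilpotent (a ^+ m).
Proof.
move=> nila; elim: m => [|m IHm]; first by rewrite expr0 -[1]scale1r;
  apply: der_nilpotentA.
by rewrite exprS; apply: der_nilpotentM.
Qed.

Lemma der_nilpotent_prod (I : Type) (r : seq I) (P : pred I) (F : I -> A) :
  (forall i, P i -> der_nilpotent (F i)) ->
    der_nilpotent (\prod_(i <- r | P i) F i).
Proof.
move=> nilF; apply: big_ind => //; last exact: der_nilpotentM.
by rewrite -[1]scale1r; apply: der_nilpotentA.
Qed.

Lemma der_nilpotent_sum (I : Type) (r : seq I) (P : pred I) (F : I -> A) :
  (forall i, P i -> der_nilpotent (F i)) ->
    der_nilpotent (\sum_(i <- r | P i) F i).
Proof.
move=> nilF; apply: big_ind => //; last exact: der_nilpotentD.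
by exists 0%N.
Qed.

Lemma der_nilpotent_of_der a : der_nilpotent (D a) -> der_nilpotent a.
Proof. by case=> m Da; exists m.+1; rewrite iterSr. Qed.

Lemma locally_nilpotentP :
  (forall a, der_nilpotent a) -> locally_nilpotent D.
Proof. by move=> nilD a; have [m Da] := nilD a; exists m.+1 => //;
  apply: der_nilpotentE. Qed.

Section Domain.
Hypothesis charK0 : [pchar K] =i pred0.
Hypothesis domA : GRing.integral_domain_axiom A.

Lemma dom_mul_neq0 (a b : A) : a != 0 -> b != 0 -> a * b != 0.
Proof.
move=> /negPf a0 /negPf b0; apply/negP => /eqP /domA.
by rewrite a0 b0.
Qed.

Lemma dom_natr_neq0 m : (0 < m)%N -> (m%:R : A) != 0.
Proof.
move=> m0; have -> : m%:R = (m%:R : K) *: (1 : A) by rewrite scaler_nat.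
by rewrite scaler_eq0 oner_eq0 orbF ((pcharf0P K).1 charK0) -lt0n.
Qed.

Hypothesis nilD : locally_nilpotent D.

(** The degree of a as a polynomial in a local slice of D; a relation, so that
    0 needs no value. *)
Definition der_degree a m := iter m D a != 0 /\ iter m.+1 D a = 0.

Lemma der_degree_exists a : a != 0 -> exists m, der_degree a m.
Proof.
move=> a0; have [m0 _ Da] := nilD a.
have ex : exists m, iter m D a == 0 by exists m0; rewrite Da.
case: (ex_minnP ex) => -[|m] /eqP Dm min;
  first by rewrite -[a]/(iter 0 D a) Dm eqxx in a0.
by exists m; split=> //; apply/negP => /min; rewrite ltnn.
Qed.

(** The top terms multiply to a nonzero element, since A is a domain of
    characteristic 0. *)
Lemma der_degree_mul a b m :
  der_degree a m -> b != 0 -> exists k, der_degree (a * b) (m + k).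
Proof.
move=> [Da Da0] /der_degree_exists[k [Db Db0]]; exists k; split.
  rewrite iter_der_mul // dom_mul_neq0 //; last exact: dom_mul_neq0.
  by rewrite dom_natr_neq0 // bin_gt0 leq_addr.
exact: iter_der_mul0.
Qed.

Lemma der_degree_uniq a m k : der_degree a m -> der_degree a k -> m = k.
Proof.
wlog lemk : m k / (m <= k)%N => [H|].
  by case: (leqP m k) => [/H|/ltnW/H H' ? ?]; [|apply/esym/H'].
case=> _ Da [Db _]; apply/eqP; rewrite eqn_leq lemk leqNgt.
by apply: contra Db => ltmk; rewrite (iter_der_ge0 Da).
Qed.

Lemma der_degree_der a m : D a != 0 -> der_degree a m ->
  exists2 k, m = k.+1 & der_degree (D a) k.
Proof.
case: m => [|m] Da0 [Da Db]; first by move: Da0;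
  rewrite -[D a]/(iter 1 D a) Db eqxx.
by exists m => //; split; rewrite -iterSr.
Qed.

(** If a divided D b and b divided D a, then each of the D-degrees of a and b
    would be smaller than the other one. *)
Lemma no_mutual_der_dvd a b u v :
  D a != 0 -> D b != 0 -> D a = b * u -> D b = a * v -> False.
Proof.
move=> Da0 Db0 Da Db.
have nz x y z : D x != 0 -> D x = y * z -> z != 0.
  by move=> + Dx; rewrite Dx; apply: contraNneq => ->; rewrite mulr0.
have nzD x : D x != 0 -> x != 0.
  by apply: contraNneq => ->; rewrite linear0.
have lt x y z n p : D x != 0 -> D y != 0 -> D x = y * z -> der_degree x n ->
    der_degree y p -> (p < n)%N.
  move=> Dx0 Dy0 Dx dx dy; have [n' -> dDx] := der_degree_der Dx0 dx.
  have [k] := der_degree_mul dy (nz _ _ _ Dx0 Dx).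
  by rewrite -Dx => /(der_degree_uniq dDx) ->; rewrite ltnS leq_addr.
have [n dn] := der_degree_exists (nzD _ Da0).
have [p dp] := der_degree_exists (nzD _ Db0).
have := ltn_trans (lt _ _ _ _ _ Da0 Db0 Da dn dp) (lt _ _ _ _ _ Db0 Da0 Db dp
  dn).
by rewrite ltnn.
Qed.

Lemma der_ndvd a u : D a != 0 -> D a = a * u -> False.
Proof. by move=> Da0 Da; apply: (no_mutual_der_dvd Da0 Da0 Da Da). Qed.

End Domain.
End Nilpotency.

Lemma linear_exists (K : fieldType) (A : lmodType K) (g : A -> A) :
  linear g -> exists D : {linear A -> A}, D =1 g.
Proof.
move=> ling; pose H := GRing.isLinear.Build K A A *:%R g ling.
by pose D : {linear A -> A} := HB.pack g H; exists D.
Qed.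

(** * Gradings given by weights of the variables *)

Lemma mpoly_ring_ind (K : nzRingType) n (P : {mpoly K[n]} -> Prop) :
    (forall c, P c%:MP) -> (forall i, P 'X_i) ->
    (forall p q, P p -> P q -> P (p + q)) ->
    (forall p q, P p -> P q -> P (p * q)) ->
  forall p, P p.
Proof.
move=> PC PX PD PM p; rewrite [p]mpolyE.
elim/big_ind: _ => [|u v|m _]; [by rewrite -mpolyC0; apply: PC | exact: PD |].
rewrite -mul_mpolyC; apply: (PM) => //; rewrite mpolyXE_id.
elim/big_ind: _ => [|u v|i _]; [exact: (PC 1) | exact: PM |].
by elim: (m i) => [|k IHk]; [apply: (PC 1) | rewrite exprS; apply: PM].
Qed.

Lemma mnm_subxx n (m : 'X_{1.. n}) : (m - m = 0)%MM.
Proof. by apply/mnmP => t; rewrite mnmBE mnm0E subnn. Qed.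

Section Gradings.
(** The algebra A is given by generators, the images of the variables. *)
Variables (K : fieldType) (n : nat) (A : comAlgType K).
Variable pi : {lrmorphism {mpoly K[n]} -> A}.
Hypothesis pi_surj : forall a, exists p, a = pi p.

Lemma pi_const c : pi c%:MP = c%:A.
Proof. by rewrite -[c%:MP]mulr1 mul_mpolyC linearZ_LR rmorph1. Qed.

Lemma der_pi (D : {linear A -> A}) (derD : derivation D) p :
  D (pi p) = \sum_t pi p^`M(t) * D (pi 'X_t).
Proof.
move: p; apply: mpoly_ring_ind => [c|i|p q IHp IHq|p q IHp IHq].
- by rewrite pi_const derA // big1 // => t _; rewrite mderivC linear0 mul0r.
- rewrite (bigD1 i) //= big1 ?addr0 => [|t ti]; rewrite mderivX mnmE.
    by rewrite eqxx scale1r mnm_subxx mpolyX0 rmorph1 mul1r.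
  by rewrite eq_sym (negPf ti) scale0r linear0 mul0r.
- rewrite !linearD IHp IHq -big_split /=; apply: eq_bigr => t _.
  by rewrite linearD linearD mulrDl.
rewrite rmorphM derD IHp IHq mulr_suml mulr_sumr -big_split /=.
apply: eq_bigr => t _; rewrite mderivM rmorphD !rmorphM; ring.
Qed.

Lemma der_var_neq0 (D : {linear A -> A}) (derD : derivation D) a :
  D a != 0 -> exists t, D (pi 'X_t) != 0.
Proof.
have [p ->] := pi_surj a; rewrite der_pi //; apply: contra_neqP => Dt0.
apply: big1 => t _; suff -> : D (pi 'X_t) = 0 by rewrite mulr0.
by apply/eqP/negPn/negP => Dt; apply: Dt0; exists t.
Qed.

Definition weight_deg (w : 'I_n -> nat) (m : 'X_{1.. n}) : nat :=
  (\sum_t m t * w t)%N.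

(** The coaction A -> A[X] of the one-dimensional torus, before it descends
    along pi: homogeneous components become coefficients, and multiplicativity
      of the
    grading becomes that of a ring morphism. *)
Definition coaction_lift (w : 'I_n -> nat) : {mpoly K[n]} -> {poly A} :=
  mmap (polyC \o in_alg A) (fun t => pi 'X_t *: 'X^(w t)).

HB.instance Definition _ w := GRing.RMorphism.copy (coaction_lift w)
  (mmap (polyC \o in_alg A) (fun t => pi 'X_t *: 'X^(w t))).

Definition is_coaction w (phi : {rmorphism A -> {poly A}}) :=
  forall p, phi (pi p) = coaction_lift w p.

Lemma coaction_lift_monomial w m :
  coaction_lift w 'X_[m] = pi 'X_[m] *: 'X^(weight_deg w m).
Proof.
rewrite /coaction_lift mmapX /mmap1 mpolyXE_id rmorph_prod /weight_deg.
rewrite (eq_bigr (fun t => (pi 'X_t ^+ m t) *: 'X^(m t * w t)));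
  last by move=> t _; rewrite exprZn -exprM mulnC.
rewrite scaler_prod prodrXr; congr (_ *: _).
by apply: eq_bigr => t _; rewrite rmorphXn.
Qed.

Lemma coaction_liftZ w c p :
  coaction_lift w (c *: p) = c%:A *: coaction_lift w p.
Proof. by rewrite /coaction_lift mmapZ /= mul_polyC. Qed.

Lemma coef_coaction_lift w e (r : seq 'X_{1.. n}) (P : pred 'X_{1.. n}) c :
  (coaction_lift w (\sum_(m <- r | P m) c m *: 'X_[m]))`_e =
  pi (\sum_(m <- r | P m && (weight_deg w m == e)) c m *: 'X_[m]).
Proof.
rewrite raddf_sum coef_sum raddf_sum /= [LHS]big_mkcond [RHS]big_mkcond /=.
apply: eq_bigr => m _; case: (P m) => //=.
rewrite coaction_liftZ coaction_lift_monomial !coefZ coefXn linearZ_LR /=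
  eq_sym.
by case: ifP => _; rewrite ?mulr1 ?mulr0 // mulr_algl.
Qed.

Definition weight_part w e (p : {mpoly K[n]}) :=
  \sum_(m <- msupp p | weight_deg w m == e) p@_m *: 'X_[m].

Lemma coef_coaction w phi : is_coaction w phi ->
  forall p e, (phi (pi p))`_e = pi (weight_part w e p).
Proof. by move=> phiE p e; rewrite phiE {1}[p]mpolyE coef_coaction_lift. Qed.

(** Two coactions are simultaneously diagonal on monomials. *)
Lemma coaction_comm w v phi psi : is_coaction w phi -> is_coaction v psi ->
  forall a d e, (psi (phi a)`_d)`_e = (phi (psi a)`_e)`_d.
Proof.
move=> phiE psiE a d e; have [p ->] := pi_surj a.
rewrite (coef_coaction phiE) psiE coef_coaction_lift.
rewrite (coef_coaction psiE) phiE coef_coaction_lift.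
by congr (pi _); apply: eq_bigl => m; rewrite andbC.
Qed.

Section OneGrading.
Variables (w : 'I_n -> nat) (phi : {rmorphism A -> {poly A}}).
Hypothesis phiE : is_coaction w phi.

Definition homogeneous d a := phi a = a *: 'X^d.

(** Indexed by int because a derivation may have negative degree; the components
    of negative index are zero. *)
Definition component (z : int) (a : A) : A :=
  if z is Posz e then (phi a)`_e else 0.

Lemma component_lt0 z a : (z < 0)%R -> component z a = 0.
Proof. by case: z. Qed.

Lemma component_is_additive z : zmod_morphism (component z).
Proof. by case: z => [e|e] a b /=; rewrite ?rmorphB ?coefB ?subrr. Qed.

HB.instance Definition _ z :=
  GRing.isZmodMorphism.Build A A (component z) (component_is_additive z).

Lemma componentZ z k a : component z (k *: a) = k *: component z a.
Proof.
case: z => [e|e] /=; last by rewrite scaler0.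
rewrite -mulr_algl -pi_const rmorphM phiE /coaction_lift mmapC /= coefCM.
by rewrite mulr_algl.
Qed.

Lemma homogeneous_component d a : homogeneous d (phi a)`_d.
Proof.
have [p ->] := pi_surj a; rewrite (coef_coaction phiE) /homogeneous phiE.
apply/polyP => e; rewrite coef_coaction_lift coefZ coefXn.
case: (eqVneq e d) => [->|ne]; rewrite ?mulr1 ?mulr0.
  by congr (pi _); apply: eq_bigl => m; rewrite andbb.
rewrite big1 ?raddf0 // => m /andP[/eqP -> /eqP de].
by rewrite de eqxx in ne.
Qed.

Lemma homogeneous_var t : homogeneous (w t) (pi 'X_t).
Proof. by rewrite /homogeneous phiE /coaction_lift mmapX mmap1U. Qed.

Lemma homogeneousM d e a b :
  homogeneous d a -> homogeneous e b -> homogeneous (d + e) (a * b).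
Proof.
rewrite /homogeneous rmorphM => -> ->.
by rewrite -scalerAl -scalerAr scalerA exprD.
Qed.

Lemma component_homogeneous d a z :
  homogeneous d a -> component z a = if z == Posz d then a else 0.
Proof.
case: z => //= e ->; rewrite coefZ coefXn eqz_nat.
by case: ifP => _; rewrite ?mulr1 ?mulr0.
Qed.

Lemma component_component z y a :
  component z (component y a) = if z == y then component y a else 0.
Proof.
case: y => [e|e]; last by rewrite /= raddf0; case: ifP.
by rewrite (component_homogeneous _ (homogeneous_component e a)).
Qed.

(** Specializing X to 1 in the coaction gives the identity of A. *)
Lemma sum_components a N : (size (phi a) <= N)%N -> a = \sum_(i < N) (phi a)`_i.
Proof.
move=> leN; suff ha : (phi a).[1] = a.
  rewrite -[LHS]ha (horner_coef_wide _ leN); apply: eq_bigr => i _.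
  by rewrite expr1n mulr1.
have [p ->] := pi_surj a; rewrite phiE.
move: p; apply: mpoly_ring_ind => [c|i|p q IHp IHq|p q IHp IHq].
- by rewrite /coaction_lift mmapC /= hornerC pi_const.
- by rewrite /coaction_lift mmapX mmap1U hornerZ hornerXn expr1n mulr1.
- by rewrite !rmorphD /= hornerD IHp IHq.
- by rewrite !rmorphM /= hornerM IHp IHq.
Qed.

Lemma componentM z d a b :
  homogeneous d b -> component z (a * b) = component (z - d%:Z) a * b.
Proof.
case: z => [e|e] homb; last by rewrite [in RHS]component_lt0 ?mul0r //; lia.
rewrite /= rmorphM homb -mul_polyC mulrA coefMXn coefMC.
case: ltnP => [lt|le]; first by rewrite component_lt0 ?mul0r //; lia.
by rewrite subzn.
Qed.

Lemma component_const c d : (d != 0)%N -> (phi c%:A)`_d = 0.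
Proof.
by move=> d0; rewrite -pi_const phiE /coaction_lift mmapC /= coefC (negPf d0).
Qed.

End OneGrading.
End Gradings.

(** * The leading component of a derivation *)

Section LeadingDerivation.
Variables (K : fieldType) (n : nat) (A : comAlgType K).
Variable pi : {lrmorphism {mpoly K[n]} -> A}.
Hypothesis pi_surj : forall a, exists p, a = pi p.
Variables (w : 'I_n -> nat) (phi : {rmorphism A -> {poly A}}).
Hypothesis phiE : is_coaction pi w phi.
Variable D : {linear A -> A}.
Hypothesis derD : derivation D.

Local Notation comp := (component phi).

(** The number c is meant to be the largest degree of a homogeneous component
    of D. *)
Variable c : int.
Hypothesis bound_var :
  forall t (z : int), (w t)%:Z + c < z -> comp z (D (pi 'X_t)) = 0.

(** The Leibniz rule propagates the bound from the variables to all of A. *)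
Lemma component_der_bound a d (z : int) :
  d%:Z + c < z -> comp z (D (phi a)`_d) = 0.
Proof.
have [p ->] := pi_surj a; move: p d z.
apply: mpoly_ring_ind => [k|t|p q IHp IHq|p q IHp IHq] d z dcz.
- rewrite pi_const; have [->|d0] := eqVneq d 0%N.
    by rewrite -(pi_const pi) phiE /coaction_lift mmapC /= coefC /= derA //
      raddf0.
  by rewrite (component_const phiE) // !raddf0.
- rewrite (homogeneous_var phiE) coefZ coefXn.
  by case: eqVneq => [ed|]; rewrite ?mulr0 ?raddf0 // mulr1 bound_var -?ed.
- by rewrite !rmorphD coefD !raddfD /= IHp // IHq // addr0.
rewrite !rmorphM coefM !raddf_sum big1 // => i _ /=; rewrite derD raddfD /=.
have homp := homogeneous_component pi_surj phiE i (pi p).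
have homq := homogeneous_component pi_surj phiE (d - i) (pi q).
have := ltn_ord i => ltid.
rewrite (componentM _ _ homq) IHp; last by lia.
rewrite [(phi (pi p))`_i * _]mulrC (componentM _ _ homp) IHq; last by lia.
by rewrite !mul0r addr0.
Qed.

Definition leading_der a : A :=
  \sum_(i < size (phi a)) comp (i%:Z + c) (D (phi a)`_i).

Lemma leading_der_wide N a : (size (phi a) <= N)%N ->
  leading_der a = \sum_(i < N) comp (i%:Z + c) (D (phi a)`_i).
Proof.
move=> leN; rewrite /leading_der.
rewrite (big_ord_widen_cond N xpredT
  (fun i => comp (i%:Z + c) (D (phi a)`_i)) leN) big_mkcond /=.
apply: eq_bigr => i _; case: ltnP => // le.
by rewrite nth_default // !raddf0.
Qed.

Lemma leading_der_is_additive : zmod_morphism leading_der.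
Proof.
move=> a b; pose N := maxn (size (phi (a - b))) (maxn (size (phi a))
  (size (phi b))).
rewrite !(@leading_der_wide N) ?leq_max ?leqnn ?orbT //.
rewrite -sumrB; apply: eq_bigr => i _.
by rewrite rmorphB coefB !raddfB.
Qed.

HB.instance Definition _ :=
  GRing.isZmodMorphism.Build A A leading_der leading_der_is_additive.

Lemma leading_derZ k a : leading_der (k *: a) = k *: leading_der a.
Proof.
pose N := maxn (size (phi (k *: a))) (size (phi a)).
rewrite !(@leading_der_wide N) ?leq_max ?leqnn ?orbT // scaler_sumr.
apply: eq_bigr => i _; have -> :
  (phi (k *: a))`_i = k *: (phi a)`_i := componentZ phiE (Posz i) k a.
by rewrite linearZ_LR (componentZ phiE).
Qed.

Lemma leading_der_homogeneous d a : homogeneous phi d a ->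
  leading_der a = comp (d%:Z + c) (D a).
Proof.
move=> homa; have [N leN ltd] : exists2 N, (size (phi a) <= N)%N & (d < N)%N.
  by exists (maxn (size (phi a)) d.+1); rewrite leq_max ?leqnn ?ltnSn ?orbT.
rewrite (leading_der_wide leN) (bigD1 (Ordinal ltd)) //= big1 ?addr0 => [|i].
  by rewrite homa coefZ coefXn eqxx mulr1.
rewrite -val_eqE /= homa coefZ coefXn => /negPf ->.
by rewrite mulr0 !raddf0.
Qed.

Lemma leading_der_leibniz a b :
  leading_der (a * b) = leading_der a * b + a * leading_der b.
Proof.
have leib_homogeneous d e x y : homogeneous phi d x -> homogeneous phi e y ->
    leading_der (x * y) = leading_der x * y + x * leading_der y.
  move=> homa homb; rewrite (leading_der_homogeneous (homogeneousM homa homb)).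
  rewrite (leading_der_homogeneous homa) (leading_der_homogeneous homb).
  rewrite derD raddfD /= (componentM _ _ homb) [x * D y]mulrC (componentM _ _
    homa).
  by rewrite [x * comp _ _]mulrC;
    congr (component _ _ _ * _ + component _ _ _ * _); lia.
rewrite (sum_components pi_surj phiE (leqnn (size (phi a)))).
elim/big_ind: _ => [|a1 a2 IH1 IH2|i _].
- by rewrite !mul0r raddf0 mul0r add0r.
- by rewrite mulrDl !raddfD /= IH1 IH2; ring.
rewrite (sum_components pi_surj phiE (leqnn (size (phi b)))).
elim/big_ind: _ => [|b1 b2 IH1 IH2|j _].
- by rewrite !mulr0 raddf0 mulr0 addr0.
- by rewrite mulrDr !raddfD /= IH1 IH2; ring.
exact: leib_homogeneous (homogeneous_component pi_surj phiE _ _)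
  (homogeneous_component pi_surj phiE _ _).
Qed.

(** If g has degree at most y, only its component of degree y contributes to the
    component of D g in degree y + c. *)
Lemma leading_step y g : (forall z : int, y < z -> comp z g = 0) ->
  (forall z : int, y + c < z -> comp z (D g) = 0) /\
  comp (y + c) (D g) = leading_der (comp y g).
Proof.
move=> topg; pose N := maxn (size (phi g)) `|y|.+1.
have gE : g = \sum_(i < N) comp i g.
  by apply: (sum_components pi_surj phiE); rewrite leq_maxl.
have zero (i : 'I_N) (z : int) :
    (y < i%:Z) || (i%:Z + c < z) -> comp z (D (comp i g)) = 0.
  by case/orP => [/topg ->|/component_der_bound->//]; rewrite !raddf0.
split=> [z yz|].
  rewrite {1}gE !raddf_sum big1 // => i _; apply: zero.
  by case: ltP => //= leiy; lia.
have ltN : (`|y| < N)%N by rewrite leq_max ltnSn orbT.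
case: y topg N ltN gE zero => [d|d] topg N ltd gE zero; last first.
  by rewrite [RHS]raddf0 {1}gE !raddf_sum big1 // => i _; exact: zero.
rewrite (leading_der_homogeneous (homogeneous_component pi_surj phiE d g)).
rewrite {1}gE !raddf_sum (bigD1 (Ordinal ltd)) //= big1 ?addr0 // => i.
by rewrite -val_eqE /= => ned; apply: zero; lia.
Qed.

(** Powers of the leading derivation are leading components of powers of D,
    which is why local nilpotency is inherited. *)
Lemma iter_leading_der m d h : homogeneous phi d h ->
  (forall z : int, d%:Z + m%:Z * c < z -> comp z (iter m D h) = 0) /\
  iter m leading_der h = comp (d%:Z + m%:Z * c) (iter m D h).
Proof.
move=> homh; elim: m => [|m [IH0 IH1]].
  rewrite mul0r addr0; split=> [z dz|] /=.
    by rewrite (component_homogeneous _ homh); case: eqVneq => // zd; lia.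
  by rewrite homh coefZ coefXn eqxx mulr1.
have [S0 S1] := leading_step IH0.
have -> : d%:Z + m.+1%:Z * c = d%:Z + m%:Z * c + c by rewrite intS; ring.
by split; rewrite // !iterS S1 IH1.
Qed.

Lemma leading_der_lnd : locally_nilpotent D ->
  exists L : {linear A -> A},
    [/\ L =1 leading_der, derivation L & locally_nilpotent L].
Proof.
move=> nilD; have [|L LE] := @linear_exists K A leading_der.
  by move=> k a b; rewrite raddfD /= leading_derZ.
exists L; split=> [//|a b|]; first by rewrite !LE leading_der_leibniz.
apply: locally_nilpotentP => a.
rewrite (sum_components pi_surj phiE (leqnn (size (phi a)))).
apply: der_nilpotent_sum => i _; have [m _ Dm] := nilD (phi a)`_i.
exists m; rewrite (eq_iter LE).
have [_ ->] := iter_leading_der m (homogeneous_component pi_surj phiE i a).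
by rewrite Dm raddf0.
Qed.

End LeadingDerivation.

(** * Homogenization of locally nilpotent derivations *)

Section Homogenization.
Variables (K : fieldType) (n : nat) (A : comAlgType K).
Variable pi : {lrmorphism {mpoly K[n]} -> A}.
Hypothesis pi_surj : forall a, exists p, a = pi p.

Definition homogeneous_der (phi : {rmorphism A -> {poly A}}) (D : A -> A) :=
  exists c : int, forall d a, homogeneous phi d a ->
  forall z, z != d%:Z + c -> component phi z (D a) = 0.

Lemma component_comm w v phi psi :
    is_coaction pi w phi -> is_coaction pi v psi ->
  forall y z a, component psi y (component phi z a) =
                component phi z (component psi y a).
Proof.
move=> phiE psiE [y|y] [z|z] a; rewrite /= ?raddf0 ?rmorph0 ?coef0 //.
exact: coaction_comm phiE psiE a z y.
Qed.

(** Finitely many generators bound the degree of D, and a variable where the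
    bound is attained shows that the leading derivation is nonzero. *)
Lemma leading_degree_exists w phi (D : {linear A -> A}) a :
    is_coaction pi w phi -> derivation D -> D a != 0 ->
  exists c : int,
    (forall t (z : int), (w t)%:Z + c < z ->
      component phi z (D (pi 'X_t)) = 0) /\
    exists t, component phi ((w t)%:Z + c) (D (pi 'X_t)) != 0.
Proof.
move=> phiE derD Da.
(* Degrees of D are at least - M, so they are shifted by M into nat. *)
pose M := (\sum_t w t)%N; pose S := (\sum_t size (phi (D (pi 'X_t%R))))%N.
have leM t : (w t <= M)%N by rewrite /M (bigD1 t) //= leq_addr.
have leS t : (size (phi (D (pi 'X_t%R))) <= S)%N by rewrite /S (bigD1 t) //=
  leq_addr.
move: M S leM leS => M S leM leS.
pose P k := [exists t, (M <= k + w t)%N && ((phi (D (pi 'X_t)))`_(k + w t - M)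
  != 0)].
have exP : exists k, P k.
  have [t Dt] := der_var_neq0 pi_surj derD Da.
  have phit : phi (D (pi 'X_t)) != 0.
    apply: contraNneq Dt => phi0.
    by rewrite (sum_components pi_surj phiE (leqnn (size (phi (D (pi 'X_t))))))
       phi0 size_poly0 big_ord0.
  have tM := leM t.
  exists ((size (phi (D (pi 'X_t)))).-1 + (M - w t))%N; apply/existsP; exists t.
  rewrite -addnA subnK // leq_addl addnK; move: phit.
  by rewrite -lead_coef_eq0 lead_coefE.
have ubP k : P k -> (k <= S + M)%N.
  case/existsP=> t /andP[leMk kt]; rewrite leqNgt; apply: contra kt => lt.
  by rewrite nth_default //; apply: leq_trans (leS t) _; lia.
case: (ex_maxnP exP ubP) => k /existsP[t /andP[leMk kt]] maxk.
exists (k%:Z - M%:Z); split=> [s z|].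
  case: z => z //= lt.
  apply: contraTeq isT => nz; have := leM s => les.
  have /maxk : P (z + M - w s)%N.
    by apply/existsP; exists s; rewrite subnK ?leq_addl ?addnK //; lia.
  lia.
exists t; have -> : (w t)%:Z + (k%:Z - M%:Z) = Posz (k + w t - M)%N by lia.
exact: kt.
Qed.

(** The coactions commute, so taking components for one grading preserves
    homogeneity for the others. *)
Lemma homogenization_step w phi (D : {linear A -> A}) a :
    is_coaction pi w phi -> derivation D -> locally_nilpotent D -> D a != 0 ->
  exists L : {linear A -> A},
    [/\ derivation L, locally_nilpotent L, exists b, L b != 0,
        homogeneous_der phi L &
        forall v psi, is_coaction pi v psi -> homogeneous_der psi D ->
          homogeneous_der psi L].
Proof.
move=> phiE derD nilD Da.
have [c [bound_c [t Dt]]] := leading_degree_exists phiE derD Da.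
have [L [LE derL nilL]] := leading_der_lnd pi_surj phiE derD bound_c nilD.
exists L; split=> //.
- exists (pi 'X_t); rewrite LE.
  by rewrite (leading_der_homogeneous _ _ (homogeneous_var phiE t)).
- exists c => d b homb z zdc; rewrite LE (leading_der_homogeneous _ _ homb).
  by rewrite (component_component pi_surj phiE) (negPf zdc).
move=> v psi psiE [k homD]; exists k => d b homb z zdk.
rewrite LE raddf_sum /= big1 // => i _.
rewrite (component_comm phiE psiE) (homD d) ?raddf0 //.
rewrite /homogeneous; apply/polyP => j.
rewrite (coaction_comm pi_surj phiE psiE) homb !coefZ !coefXn.
by case: (j == d); rewrite ?mulr1 ?mulr0 ?rmorph0 ?coef0.
Qed.

Lemma homogenization (v : 'I_n -> 'I_n -> nat)
    (psi : 'I_n -> {rmorphism A -> {poly A}}) (D : {linear A -> A}) a :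
    (forall t, is_coaction pi (v t) (psi t)) ->
    derivation D -> locally_nilpotent D -> D a != 0 ->
  exists L : {linear A -> A},
    [/\ derivation L, locally_nilpotent L, exists b, L b != 0 &
        forall t, homogeneous_der (psi t) L].
Proof.
move=> psiE derD nilD Da.
suff H r : exists L : {linear A -> A},
    [/\ derivation L, locally_nilpotent L, exists b, L b != 0 &
        forall t : 'I_n, (t < r)%N -> homogeneous_der (psi t) L].
  by have [L [? ? ? homL]] := H n; exists L; split=> // t; apply: homL.
elim: r => [|r [L [derL nilL [b Lb] homL]]]; first by exists D; split=> //;
  exists a.
have [ltrn|lenr] := ltnP r n; last first.
  by exists L; split=> //; [exists b | move=> t _; apply: homL;
    apply: leq_trans lenr].
have [L' [derL' nilL' L'0 homr homL']] :=
  homogenization_step (psiE (Ordinal ltrn)) derL nilL Lb.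
exists L'; split=> // t; rewrite ltnS leq_eqVlt => /orP[/eqP tr|/homL].
  by have -> : t = Ordinal ltrn by apply: val_inj.
exact: homL'.
Qed.

Lemma homogeneous_part_eq w phi z a : is_coaction pi w phi ->
  (forall y, y != z -> component phi y a = 0) -> a = component phi z a.
Proof.
move=> phiE homa; case: z homa => [d|d] homa.
  have [N leN ltd] : exists2 N, (size (phi a) <= N)%N & (d < N)%N.
    by exists (maxn (size (phi a)) d.+1); rewrite leq_max ?leqnn ?ltnSn ?orbT.
  rewrite [LHS](sum_components pi_surj phiE leN) (bigD1 (Ordinal ltd)) //=.
  rewrite big1 ?addr0 // => i id; apply: (homa i).
  by apply: contra id => /eqP[] id; apply/eqP/val_inj.
rewrite [LHS](sum_components pi_surj phiE (leqnn (size (phi a)))) big1 //.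
by move=> i _; apply: (homa i).
Qed.

(** In a monomial of weight d, the exponent of the variable t is d modulo e;
    so it is positive unless e divides d. *)
Lemma var_dvd_homogeneous w phi t e z a : is_coaction pi w phi ->
    (w t = 1 %[mod e])%N -> (forall s, s != t -> e %| w s)%N ->
    (forall y, y != z -> component phi y a = 0) -> ~~ (e%:Z %| z)%Z ->
  exists b, a = pi 'X_t * b.
Proof.
move=> phiE wt ws homa ndvd; rewrite (homogeneous_part_eq phiE homa).
case: z homa ndvd => d homa ndvd; last by exists 0; rewrite mulr0.
have [p ->] := pi_surj a; rewrite /= (coef_coaction phiE) /weight_part.
elim/big_rec: _ => [|m q /eqP md [b IHq]]; first by exists 0;
  rewrite raddf0 mulr0.
have mt : (0 < m t)%N.
  rewrite lt0n; apply: contraNneq ndvd => mt0; rewrite dvdzE /=.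
  rewrite -md; apply: dvdn_sum => s _.
  by case: (eqVneq s t) => [->|/ws]; [rewrite mt0 | apply: dvdn_mull].
exists (p@_m *: pi 'X_[m - U_(t)] + b).
rewrite raddfD /= IHq mulrDr; congr (_ + _).
rewrite linearZ_LR -scalerAr -rmorphM -mpolyXD; congr (_ *: pi 'X_[_]).
apply/mnmP => s; rewrite mnmDE mnmBE mnm1E.
by case: (eqVneq t s) => [<-|] /=; lia.
Qed.

Hypothesis charK0 : [pchar K] =i pred0.
Hypothesis domA : GRing.integral_domain_axiom A.

(** Suppose that D x_u is nonzero. In the grading attached to u, its weight must
    be 0 modulo e u, as otherwise x_u would divide it. Then the weight of D x_s
    is -1 modulo e u for all other s, so that x_u divides D x_s; for two such
    variables the divisibility would be mutual. *)
Lemma lnd_single_variable (e : 'I_n -> nat) (v : 'I_n -> 'I_n -> nat)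
    (psi : 'I_n -> {rmorphism A -> {poly A}}) (D : {linear A -> A}) a :
    (forall t, is_coaction pi (v t) (psi t)) -> (forall t, 2 <= e t)%N ->
    (forall t, v t t = 1 %[mod e t])%N ->
    (forall s t, s != t -> e t %| v t s)%N ->
    derivation D -> locally_nilpotent D -> D a != 0 ->
  exists (L : {linear A -> A}) t,
    [/\ derivation L, L (pi 'X_t) != 0 &
        forall s, s != t -> L (pi 'X_s) = 0].
Proof.
move=> psiE e2 vt vs derD nilD Da.
have [L [derL nilL [b Lb] homL]] := homogenization psiE derD nilD Da.
have [t Lt] := der_var_neq0 pi_surj derL Lb.
have dvd s u : s != u -> L (pi 'X_u) != 0 ->
  exists b', L (pi 'X_s) = pi 'X_u * b'.
  move=> su Lu; have [c homLc] := homL u.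
  have homs r := homLc _ _ (homogeneous_var (psiE u) r).
  have dvdu : (e u %| (v u u)%:Z + c)%Z.
    apply/negPn/negP => ndvd.
    have [b' Lu'] := var_dvd_homogeneous (psiE u) (vt u) (fun s =>
      @vs s u) (homs u) ndvd.
    exact: (der_ndvd derL charK0 domA nilL Lu Lu').
  apply: (var_dvd_homogeneous (psiE u) (vt u) (fun s => @vs s u) (homs s)).
  apply/negP => dvds; have e2u := e2 u.
  have : (e u %| (v u u)%:Z - (v u s)%:Z)%Z.
    by have -> : (v u u)%:Z - (v u s)%:Z = (v u u)%:Z + c - ((v u s)%:Z + c);
      [ring | apply: rpredB].
  rewrite rpredBr; last by rewrite dvdzE /= vs.
  by rewrite dvdzE /= /dvdn vt modn_small.
exists L, t; split=> // s st; apply/eqP/negPn/negP => Ls.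
have [b1 E1] := dvd _ _ st Lt.
rewrite eq_sym in st; have [b2 E2] := dvd _ _ st Ls.
exact: (no_mutual_der_dvd derL charK0 domA nilL Ls Lt E1 E2).
Qed.

End Homogenization.

(** * Trinomial algebras, and exponents equal to 1 *)

Lemma nth_root_exists (K : closedFieldType) k (a : K) :
  (0 < k)%N -> exists z, z ^+ k = a.
Proof.
move=> k0; have /closed_rootP[z] : size ('X^k - a%:P : {poly K}) != 1%N.
  by rewrite size_XnsubC // eqSS -lt0n.
rewrite rootE !hornerE subr_eq0 => /eqP za; exists z; exact: za.
Qed.

Section TrinomialAlgebra.
(** The variables form one family, coloured by c according to the block that
    contains them; e gives the exponents. *)
Variables (K : closedFieldType) (n : nat) (A : comAlgType K).
Variables (c : 'I_n -> 'I_3) (e : 'I_n -> nat).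
Hypothesis e_gt0 : forall t, (0 < e t)%N.

Definition block i : 'X_{1.. n} :=
  [multinom (if c t == i then e t else 0)%N | t < n].

Definition block_trinomial : {mpoly K[n]} := \sum_i 'X_[block i].

Local Notation f := block_trinomial.

Variable pi : {lrmorphism {mpoly K[n]} -> A}.
Hypothesis pi_surj : forall a, exists p, a = pi p.
Hypothesis pi_ker : forall p, pi p = 0 <-> exists g, p = g * f.

Lemma pi_block_trinomial : pi f = 0.
Proof. by apply/pi_ker; exists 1; rewrite mul1r. Qed.

Lemma mderiv_block_trinomial x :
  f^`M(x) = (e x)%:R *: 'X_[block (c x) - U_(x)].
Proof.
rewrite raddf_sum (bigD1 (c x)) //= mderivX mnmE eqxx big1 ?addr0 // => i ic.
by rewrite mderivX mnmE eq_sym (negPf ic) scale0r.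
Qed.

Lemma meval_block v i :
  ('X_[K, block i]).@[v] = \prod_(t | c t == i) v t ^+ e t.
Proof.
rewrite mevalX [RHS]big_mkcond; apply: eq_bigr => t _.
by rewrite mnmE; case: ifP.
Qed.

Lemma meval_block1 v i : (forall t, c t = i -> v t = 1) ->
  ('X_[K, block i]).@[v] = 1.
Proof. by move=> v1; rewrite meval_block big1 // => t /eqP/v1->;
  rewrite expr1n. Qed.

Lemma meval_block_var v x : (forall t, t != x -> c t = c x -> v t = 1) ->
  ('X_[K, block (c x)]).@[v] = v x ^+ e x.
Proof.
move=> v1; rewrite meval_block (bigD1 x) //= big1 ?mulr1 // =>
  t /andP[/eqP ct tx].
by rewrite v1 ?expr1n.
Qed.

Lemma meval_neq0 v p : f.@[v] = 0 -> p.@[v] != 0 -> pi p != 0.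
Proof.
move=> fv; apply: contraNneq => /pi_ker[g ->].
by rewrite mevalM fv mulr0.
Qed.

Section Rigidity.
Hypothesis charK0 : [pchar K] =i pred0.

(** Put 1 for all coordinates but x, and -2 for the value of the block of x. *)
Lemma point_off_axes (x : 'I_n) :
  exists v : 'I_n -> K, f.@[v] = 0 /\ forall t, v t != 0.
Proof.
have [z zE] := nth_root_exists (- 2%:R : K) (e_gt0 x).
exists (fun t => if t == x then z else 1); split=> [|t].
  rewrite raddf_sum (bigD1 (c x)) //= meval_block_var ?eqxx => [|t /negPf ->
    //].
  rewrite zE (eq_bigr (fun=> 1)) => [|i ic]; last first.
    by rewrite meval_block1 // => t ct; have [tx|//] := eqVneq t x; move: ic;
      rewrite -ct tx eqxx.
  rewrite sumr_const cardC1 card_ord; exact: addNr.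
case: (t == x); last exact: oner_neq0.
apply: contra_eq_neq zE => ->; rewrite expr0n eqn0Ngt e_gt0 eq_sym oppr_eq0.
by rewrite ((pcharf0P K).1 charK0).
Qed.

(** The partial derivative is a nonzero multiple of a monomial, and some point
    of the hypersurface has no zero coordinate. *)
Lemma pi_mderiv_neq0 x : pi f^`M(x) != 0.
Proof.
have [v [fv v0]] := point_off_axes x; apply: (meval_neq0 fv).
rewrite mderiv_block_trinomial mevalZ mulf_neq0 ?((pcharf0P K).1 charK0) -?lt0n
  //.
by rewrite mevalX; apply/prodf_neq0 => t _; apply: expf_neq0.
Qed.

(** The Hamiltonian vector field of f in the plane of the variables x and y. *)
Lemma hamiltonian_der x y : exists D : {linear A -> A}, derivation D /\
  forall p, D (pi p) = pi (f^`M(y) * p^`M(x) - f^`M(x) * p^`M(y)).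
Proof.
pose h p := pi (f^`M(y) * p^`M(x) - f^`M(x) * p^`M(y)).
have h_ker p : pi p = 0 -> h p = 0.
  move=> /pi_ker[g ->]; apply/pi_ker.
  exists (f^`M(y) * g^`M(x) - f^`M(x) * g^`M(y)); rewrite !mderivM; ring.
have hB p q : h (p - q) = h p - h q.
  by rewrite /h -rmorphB !mderivB; congr (pi _); ring.
have h_eq p q : pi p = pi q -> h p = h q.
  move=> epq; apply/eqP; rewrite -subr_eq0 -hB; apply/eqP/h_ker.
  by rewrite rmorphB /= epq subrr.
pose lift a := projT1 (cid (pi_surj a)).
have liftE a : pi (lift a) = a by rewrite -(projT2 (cid (pi_surj a))).
have [k a b|D DE] := @linear_exists K A (fun a => h (lift a)).
  rewrite (h_eq _ (k *: lift a + lift b)); last by rewrite linearP /= !liftE.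
  by rewrite /h -linearP !mderivD !mderivZ -!mul_mpolyC; congr (pi _); ring.
have Dpi p : D (pi p) = h p by rewrite DE; apply: h_eq; rewrite liftE.
exists D; split=> // a b; have [[p ->] [q ->]] := (pi_surj a, pi_surj b).
rewrite -rmorphM !Dpi /h -!rmorphM -rmorphD !mderivM; congr (pi _); ring.
Qed.

(** The Hamiltonian derivation for x and y is triangular: it sends the other
    variables to 0, y to minus a monomial in these, and x to a polynomial in
    these and y. *)
Lemma not_rigid_of_exponent1 x y :
  c x != c y -> e x = 1%N -> ~ has_no_nonzero_lnd A.
Proof.
move=> cxy ex rigA; have [D [derD DE]] := hamiltonian_der x y.
have xy : x != y by apply: contraNneq cxy => ->.
have Dvar t : D (pi 'X_t) = (t == x)%:R * pi f^`M(y) - (t == y)%:R * pi f^`M(x).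
  have dX s : 'X_t^`M(s) = (t == s)%:R :> {mpoly K[n]}.
    rewrite mderivX mnmE; case: eqVneq => [->|_]; last by rewrite scale0r.
    by rewrite scale1r mnm_subxx mpolyX0.
  by rewrite DE !dX rmorphB !rmorphM !rmorph_nat mulrC [X in _ - X]mulrC.
have nilX (m : 'X_{1.. n}) :
  (forall t, (0 < m t)%N -> der_nilpotent D (pi 'X_t)) ->
    der_nilpotent D (pi 'X_[m]).
  move=> nilm; rewrite mpolyXE_id rmorph_prod;
    apply: der_nilpotent_prod => // t _.
  rewrite rmorphXn /=; case: (posnP (m t)) => [->|/nilm];
    last exact: der_nilpotentX.
  by rewrite expr0 -[1]scale1r; apply: der_nilpotentA.
have nilZ k a : der_nilpotent D a -> der_nilpotent D (k *: a).
  by rewrite -mulr_algl => nila; apply: der_nilpotentM => //;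
    apply: der_nilpotentA.
have nil_other t : t != x -> t != y -> der_nilpotent D (pi 'X_t).
  by move=> /negPf tx /negPf ty; exists 1%N; rewrite /= Dvar tx ty !mul0r subr0.
have nil_y : der_nilpotent D (pi 'X_y).
  apply: der_nilpotent_of_der;
    rewrite Dvar eqxx eq_sym (negPf xy) mul0r mul1r add0r.
  rewrite mderiv_block_trinomial -linearN -scaleNr linearZ_LR;
    apply/nilZ/nilX => t.
  rewrite mnmBE !mnmE; case: eqVneq => // ct; case: (eqVneq x t) => [<-|xt _].
    by rewrite ex.
  by apply: nil_other; rewrite 1?eq_sym //; apply: contraNneq cxy => ->;
    rewrite -ct.
have nil_x : der_nilpotent D (pi 'X_x).
  apply: der_nilpotent_of_der; rewrite Dvar eqxx (negPf xy) mul0r mul1r subr0.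
  rewrite mderiv_block_trinomial linearZ_LR; apply/nilZ/nilX => t.
  rewrite mnmBE !mnmE; case: eqVneq => // ct _; case: (eqVneq t y) => [->//|ty].
  by apply: nil_other => //; apply: contraNneq cxy => <-; rewrite ct.
have nilD : locally_nilpotent D.
  apply: locally_nilpotentP => a; have [p ->] := pi_surj a.
  rewrite [p]mpolyE raddf_sum; apply: der_nilpotent_sum => m _ /=.
  rewrite linearZ_LR; apply/nilZ/nilX => t _.
  by case: (eqVneq t x) => [->//|tx]; case: (eqVneq t y) => [->//|];
    apply: nil_other.
have := rigA D derD nilD (pi 'X_y);
  rewrite Dvar eqxx eq_sym (negPf xy) mul0r add0r mul1r.
by move/eqP; rewrite oppr_eq0; apply/negP/pi_mderiv_neq0.
Qed.

(** When all blocks have the same weight N, the lifted coaction multiplies the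
    trinomial by X^N, so it preserves the ideal. *)
Lemma coaction_exists (w : 'I_n -> nat) N :
  (forall i, \sum_(t | c t == i) e t * w t = N)%N ->
  exists phi : {rmorphism A -> {poly A}}, is_coaction pi w phi.
Proof.
move=> sumw; have lift_ker p : pi p = 0 -> coaction_lift pi w p = 0.
  case/pi_ker => g ->; rewrite rmorphM /=.
  suff -> : coaction_lift pi w f = 0 by rewrite mulr0.
  have -> : coaction_lift pi w f = pi f *: 'X^N;
    last by rewrite pi_block_trinomial scale0r.
  rewrite !raddf_sum scaler_suml; apply: eq_bigr => i _.
  rewrite /= coaction_lift_monomial -(sumw i); congr (_ *: 'X^_).
  rewrite /weight_deg [RHS]big_mkcond; apply: eq_bigr => t _.
  by rewrite mnmE; case: ifP.
have lift_eq p q : pi p = pi q -> coaction_lift pi w p = coaction_lift pi w q.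
  move=> epq; apply/eqP; rewrite -subr_eq0 -rmorphB; apply/eqP/lift_ker.
  by rewrite rmorphB /= epq subrr.
pose lift a := projT1 (cid (pi_surj a)).
have liftE a : pi (lift a) = a by rewrite -(projT2 (cid (pi_surj a))).
pose g a := coaction_lift pi w (lift a).
have gB : zmod_morphism g.
  by move=> a b; rewrite /g -rmorphB; apply: lift_eq; rewrite rmorphB /= !liftE.
have gM : monoid_morphism g.
  split=> [|a b]; first by rewrite /g -(rmorph1 (coaction_lift pi w));
    apply: lift_eq; rewrite rmorph1 liftE.
  by rewrite /g -rmorphM; apply: lift_eq; rewrite rmorphM /= !liftE.
pose HA := GRing.isZmodMorphism.Build A {poly A} g gB.
pose HM := GRing.isMonoidMorphism.Build A {poly A} g gM.
pose phi : {rmorphism A -> {poly A}} := HB.pack g HA HM.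
by exists phi => p; apply: lift_eq; rewrite liftE.
Qed.

End Rigidity.
End TrinomialAlgebra.

(** * Prime elements and gradings attached to the exponents *)

(** Compare p times a factorization of z with the product of factorizations of x
    and y: by uniqueness, p is associated with a factor of x or of y. *)
Lemma ufd_irreducible_prime (R : comUnitRingType) (p x y z : R) :
    is_ufd R -> irreducible_elt p -> p * z = x * y ->
  (exists u, x = p * u) \/ (exists u, y = p * u).
Proof.
move=> [dom fact uniq] irrp pz; have [p0 pU pirr] := irrp.
have [->|x0] := eqVneq x 0; first by left; exists 0; rewrite mulr0.
have [->|y0] := eqVneq y 0; first by right; exists 0; rewrite mulr0.
have [xU|xU] := boolP (x \is a GRing.unit).
  by right; exists (z * x^-1); rewrite mulrA pz [x * y]mulrC mulrK.
have [yU|yU] := boolP (y \is a GRing.unit).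
  by left; exists (z * y^-1); rewrite mulrA pz mulrK.
have [zU|zU] := boolP (z \is a GRing.unit).
  case: (pirr x (y * z^-1)) => [||]; first by rewrite mulrA -pz mulrK.
    by rewrite (negPf xU).
  by rewrite unitrM unitrV zU (negPf yU).
have z0 : z != 0.
  apply: contra_eq_neq pz => ->; rewrite mulr0 eq_sym; apply/eqP => /dom.
  by rewrite (negPf x0) (negPf y0).
have [s irrs xE] := fact x x0 xU; have [t irrt yE] := fact y y0 yU.
have [r irrr zE] := fact z z0 zU.
have dvd_prod q (l : seq R) u :
  q \in l -> q = u * p -> exists v, \prod_(a <- l) a = p * v.
  by move=> ql qE; rewrite (big_rem _ ql) /= {1}qE;
    exists (u * \prod_(a <- rem q l) a); rewrite [u * p]mulrC [RHS]mulrA.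
have [t' [perm_t' size_t' assoc]] : exists t' : seq R,
    [/\ perm_eq (s ++ t) t', size (p :: r) = size t' &
        forall i, (i < size (p :: r))%N -> associated (p :: r)`_i t'`_i].
  apply: uniq; last by rewrite big_cons big_cat /= -zE -xE -yE.
    by move=> a; rewrite inE => /orP[/eqP->//|/irrr].
  by move=> a; rewrite mem_cat => /orP[/irrs|/irrt].
have [u _ /= t'0] := assoc 0%N isT.
have : t'`_0 \in s ++ t by rewrite (perm_mem perm_t') mem_nth // -size_t'.
by rewrite mem_cat xE yE => /orP[] h; [left|right]; apply: dvd_prod h t'0.
Qed.

Section Weights.
Variables (n : nat) (c : 'I_n -> 'I_3) (e : 'I_n -> nat).
Hypothesis e_gt0 : forall t, (0 < e t)%N.
Hypothesis c_surj : forall i, exists t, c t = i.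

(** Each variable gets a weight inversely proportional to its exponent and to
    the number of variables in its block. *)
Lemma positive_weight : exists (w : 'I_n -> nat) (N : nat),
  (forall t, 0 < w t)%N /\ (forall i, \sum_(t | c t == i) e t * w t = N)%N.
Proof.
pose L := (\prod_t e t)%N; pose b i := #|[pred t | c t == i]|.
have b0 i : (0 < b i)%N by have [t ct] := c_surj i; apply/card_gt0P; exists t;
  rewrite inE ct.
have dvdL t : (e t %| L)%N by rewrite /L (bigD1 t) //= dvdn_mulr.
have L0 : (0 < L)%N by apply: prodn_gt0.
exists (fun t => L %/ e t * \prod_(i | i != c t) b i)%N, (L * \prod_i b i)%N.
split=> [t|i].
  by rewrite muln_gt0 divn_gt0 // dvdn_leq // prodn_cond_gt0.
rewrite (eq_bigr (fun=> L * \prod_(j | j != i) b j)%N) => [|t /eqP ct].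
  by rewrite sum_nat_const [in RHS](bigD1 i) //= mulnCA.
by rewrite ct mulnA [(e t * _)%N]mulnC divnK.
Qed.

Definition block_gcd i := (\big[gcdn/0]_(t | c t == i) e t)%N.

Lemma block_gcd_dvd t : (block_gcd (c t) %| e t)%N.
Proof. by apply: (biggcdn_inf t). Qed.

Lemma block_bezout i (m : int) : (block_gcd i %| m)%Z ->
  exists q : 'I_n -> int, \sum_(t | c t == i) (e t)%:Z * q t = m.
Proof.
case/dvdzP => k ->.
suff [q <-] : exists q : 'I_n -> int,
    \sum_(t | c t == i) (e t)%:Z * q t = block_gcd i.
  by exists (fun t => k * q t); rewrite mulr_sumr; apply: eq_bigr => t _; ring.
rewrite /block_gcd.
pose Q (g : nat) :=
  exists q : 'I_n -> int, \sum_(t | c t == i) (e t)%:Z * q t = g.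
apply: (big_ind Q) => [|a b [q qa] [r rb]|s cs].
- by exists (fun=> 0); rewrite big1 // => t _; rewrite mulr0.
- have [u [v uv]] := Bezoutz a b; exists (fun t => u * q t + v * r t).
  transitivity (u * a%:Z + v * b%:Z); last exact: uv.
  by rewrite -qa -rb !mulr_sumr -big_split; apply: eq_bigr => t _ /=; ring.
exists (fun t => (t == s)%:R);
  rewrite (bigD1 s) //= eqxx mulr1 big1 ?addr0 // => t.
by case/andP=> _ /negPf ->; rewrite mulr0.
Qed.

(** The grading group of the trinomial is torsion free when the gcds of the
    blocks are pairwise coprime, so a weight in Z/e(x) lifts to Z. *)
Lemma modular_weight x :
    (forall i j, i != j -> coprime (block_gcd i) (block_gcd j)) ->
  exists (v : 'I_n -> nat) (N : nat),
    [/\ forall i, (\sum_(t | c t == i) e t * v t = N)%N,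
        (v x = 1 %[mod e x])%N &
        forall t, t != x -> (e x %| v t)%N].
Proof.
move=> cop; pose P := (\prod_(j | j != c x) block_gcd j)%N.
have copP : coprime (block_gcd (c x)) P.
  rewrite /P; apply: (big_ind (coprime (block_gcd (c x)))) =>
    [|a b ca cb|j jx]; first exact: coprimen1.
    by rewrite coprimeMr ca.
  by rewrite cop // eq_sym.
(* Before a final shift, all blocks will have weight e x * N0. The residue 1 of x
   contributes e x to its block, and all else comes from multiples of e x; so N0
   is 1 modulo the gcd of the block of x, and 0 modulo the other two gcds. *)
pose N0 := chinese (block_gcd (c x)) P 1 0.
have dvdN j : (block_gcd j %| N0%:Z - (j == c x)%:Z)%Z.
  case: eqVneq => [->|jx] /=.
    by rewrite -eqz_mod_dvd !modz_nat eqz_nat; apply/eqP; rewrite chinese_modl.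
  rewrite subr0 dvdzE /=; apply: (@dvdn_trans P);
    first by rewrite /P (bigD1 j) //= dvdn_mulr.
  by have := chinese_modr copP 1 0; rewrite mod0n => /eqP.
have [q qE] := fin_all_exists (fun j => block_bezout (dvdN j)).
have [w [M [w0 wE]]] := positive_weight.
pose vi t : int := (t == x)%:R + (e x)%:Z * q (c t) t.
(* A large multiple of a positive grading, itself a multiple of e x, makes the
   weights nonnegative. *)
pose B := (\sum_t `|vi t|)%N.
pose v t := vi t + (e x)%:Z * (B%:Z * (w t)%:Z).
have v_ge0 t : (`|v t|%N)%:Z = v t.
  rewrite abszE ger0_norm // /v.
  have leB : (`|vi t| <= B)%N by rewrite /B (bigD1 t) //= leq_addr.
  have : (`|vi t| <= e x * (B * w t))%N.
    apply: (leq_trans leB); rewrite mulnCA leq_pmulr // muln_gt0 e_gt0 w0 //.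
  lia.
pose T := (e x)%:Z * (N0%:Z + B%:Z * M%:Z).
have T_ge0 : (`|T|%N)%:Z = T by rewrite abszE ger0_norm // mulr_ge0 // addr_ge0
  // mulr_ge0.
exists (fun t => `|v t|%N), (`|T|%N); split=> [i||t tx].
- apply/eqP; rewrite -eqz_nat T_ge0 (big_morph Posz PoszD (erefl _)); apply/eqP.
  transitivity (\sum_(t | c t == i) (e t)%:Z * (t == x)%:R +
    (e x)%:Z * (\sum_(t | c t == i) (e t)%:Z * q i t) +
    (e x)%:Z * B%:Z * (\sum_(t | c t == i) (e t)%:Z * (w t)%:Z)).
    rewrite !mulr_sumr -!big_split; apply: eq_bigr => t /eqP ct /=.
    by rewrite PoszM v_ge0 /v /vi ct; ring.
  have -> : \sum_(t | c t == i) (e t)%:Z * (w t)%:Z = M%:Z.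
    rewrite -(wE i) (big_morph Posz PoszD (erefl _)).
    by apply: eq_bigr => t _; rewrite PoszM.
  have -> : \sum_(t | c t == i) (e t)%:Z * (t == x)%:R =
            (i == c x)%:Z * (e x)%:Z.
    rewrite [i == _]eq_sym; have [cx|cx] := eqVneq (c x) i.
      rewrite (bigD1 x) ?cx ?eqxx //= big1 ?addr0 ?mulr1 ?mul1r // => t.
      by case/andP=> _ /negPf ->; rewrite mulr0.
    rewrite mul0r big1 // => t /eqP ct; case: eqVneq => [tx|];
      last by rewrite mulr0.
    by rewrite -ct tx eqxx in cx.
  rewrite qE /T; have aux (k a p s r : int) :
    k * a + a * (p - k) + a * s * r = a * (p + s * r) by ring.
  exact: aux.
- apply/eqP; rewrite -eqz_nat -!modz_nat eqz_mod_dvd v_ge0 /v /vi eqxx.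
  have -> : true%:R + (e x)%:Z * q (c x) x + (e x)%:Z * (B%:Z * (w x)%:Z) - 1 =
            (e x)%:Z * (q (c x) x + B%:Z * (w x)%:Z).
    by rewrite addrAC [_ - 1]addrAC subrr add0r mulrDr.
  exact: dvdz_mulr.
suff : (e x %| v t)%Z by rewrite dvdzE.
by rewrite /v /vi (negPf tx) add0r -mulrDr dvdz_mulr.
Qed.
End Weights.

(** * Factorial trinomial algebras *)

Lemma third_index (i k : 'I_3) : i != k ->
  exists m : 'I_3, [/\ m != i, m != k & forall j, j != i -> j != k -> j = m].
Proof.
move=> ik; have ltm : (3 - i - k < 3)%N.
  by move: ik; rewrite -val_eqE /=; have := ltn_ord i; have := ltn_ord k; lia.
exists (Ordinal ltm); split=> [||j]; last (move=> ji jk; apply: val_inj;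
  move: ji jk);
  move: ik (ltn_ord i) (ltn_ord k); rewrite -!val_eqE /=; try lia.
by have := ltn_ord j; lia.
Qed.

(** As P_0 <> 0, the lowest terms of Q and P * Q have the same degree; so Q
    already has degree w, which leaves degree 0 for P. *)
Lemma const_factor_of_monomial (R : comNzRingType) (P Q : {poly R}) s w :
    GRing.integral_domain_axiom R -> s != 0 -> P * Q = s *: 'X^w -> P`_0 != 0 ->
  (size P <= 1)%N.
Proof.
move=> dom s0 PQ P0.
have mul0 (x y : R) : x != 0 -> y != 0 -> x * y != 0.
  by move=> /negPf x0 /negPf y0; apply/eqP => /dom; rewrite x0 y0.
have coefPQ j : (P * Q)`_j = if j == w then s else 0.
  by rewrite PQ coefZ coefXn; case: (j == w); rewrite ?mulr1 ?mulr0.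
have Qn0 : Q != 0.
  apply: contraNneq s0 => Q0; have := coefPQ w.
  by rewrite Q0 mulr0 coef0 eqxx => <-.
have Pn0 : P != 0 by apply: contraNneq P0 => ->; rewrite coef0.
have exQ : exists j, Q`_j != 0 by exists (size Q).-1;
  rewrite -lead_coefE lead_coef_eq0.
have Qw : Q`_w != 0.
  case: (ex_minnP exQ) => j Qj minj.
  have : (P * Q)`_j = P`_0 * Q`_j.
    rewrite coefM big_ord_recl subn0 big1 ?addr0 // => i _ /=.
    rewrite (_ : Q`_(j - bump 0 i) = 0) ?mulr0 //;
      apply/eqP/negPn/negP => /minj.
    by have := ltn_ord i; rewrite /bump /=; lia.
  rewrite coefPQ; case: eqP => [<- //|_ /eqP].
  by rewrite eq_sym (negPf (mul0 _ _ P0 Qj)).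
have ltw : (w < size Q)%N.
  by rewrite ltnNge; apply: contra Qw => le; rewrite nth_default.
have : (size (P * Q)%R <= w.+1)%N.
  by apply/leq_sizeP => j ltj; rewrite coefPQ; case: eqP => // jw;
    rewrite jw ltnn in ltj.
rewrite size_proper_mul; first by lia.
by rewrite mul0 // lead_coef_eq0.
Qed.

Section FactorialTrinomial.
Variables (K : closedFieldType) (n : nat) (A : comUnitAlgType K).
Variables (c : 'I_n -> 'I_3) (e : 'I_n -> nat).
Hypothesis c_surj : forall i, exists t, c t = i.
Hypothesis e_ge2 : forall t, (2 <= e t)%N.
Local Notation f := (block_trinomial K c e).
Variable pi : {lrmorphism {mpoly K[n]} -> A}.
Hypothesis pi_surj : forall a, exists p, a = pi p.
Hypothesis pi_ker : forall p, pi p = 0 <-> exists g, p = g * f.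
Hypothesis charK0 : [pchar K] =i pred0.
Hypothesis ufdA : is_ufd A.

Let domA : GRing.integral_domain_axiom A. Proof. by case: ufdA. Qed.
Let e_gt0 t : (0 < e t)%N. Proof. exact: leq_trans (e_ge2 t). Qed.

Local Notation ev0 := (fun=> 0 : K).

Lemma meval0_monomial (m : 'X_{1.. n}) t :
  (0 < m t)%N -> ('X_[K, m]).@[ev0] = 0.
Proof. by move=> mt; rewrite mevalX (bigD1 t) //= expr0n eqn0Ngt mt mul0r. Qed.

Lemma meval0_trinomial : f.@[ev0] = 0.
Proof.
rewrite raddf_sum big1 // => i _; have [t ct] := c_surj i.
by apply: (meval0_monomial (t := t)); rewrite mnmE ct eqxx.
Qed.

Lemma meval0_mderiv_trinomial t : (f^`M(t)).@[ev0] = 0.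
Proof.
rewrite mderiv_block_trinomial // mevalZ (meval0_monomial (t := t)) ?mulr0 //.
by rewrite mnmBE !mnmE !eqxx /= subn_gt0.
Qed.

(** A variable does not lie in the square of the maximal ideal of the origin,
    so one of two factors is nonzero at the origin; by homogeneity for a
    positive grading, this factor is a constant. *)
Lemma var_irreducible z : irreducible_elt (pi 'X_z).
Proof.
have [w [N [w0 wE]]] := positive_weight e_gt0 c_surj.
have [phi phiE] := coaction_exists pi_surj pi_ker wE.
have [v [fv v0]] := point_off_axes c e_gt0 charK0 z.
have z0 : pi 'X_z != 0 by apply: (meval_neq0 pi_ker fv); rewrite mevalXU.
have phi0 p : (phi (pi p))`_0 = p.@[ev0]%:A.
  move: p; apply: mpoly_ring_ind => [k|t|p q IHp IHq|p q IHp IHq].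
  - by rewrite phiE /coaction_lift mmapC /= coefC mevalC.
  - by rewrite (homogeneous_var phiE) coefZ coefXn mevalXU eq_sym eqn0Ngt w0
    mulr0 scale0r.
  - by rewrite !rmorphD coefD IHp IHq scalerDl.
  - by rewrite !rmorphM coef0M IHp IHq /= -scalerAl mul1r scalerA.
have factor p q : pi 'X_z = pi p * pi q -> p.@[ev0] != 0 ->
  pi p \is a GRing.unit.
  move=> pq p0; have : (size (phi (pi p)) <= 1)%N.
    apply: (@const_factor_of_monomial _ _ (phi (pi q)) (pi 'X_z) (w z)) => //.
      by rewrite -rmorphM -pq; apply: homogeneous_var phiE z.
    by rewrite phi0 scaler_eq0 (negPf p0) oner_eq0.
  move/(sum_components pi_surj phiE); rewrite big_ord1 phi0 => ->.
  by apply/unitrPr; exists (p.@[ev0]^-1)%:A;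
    rewrite -scalerAl mul1r scalerA mulfV ?scale1r.
split=> // [|a b].
  apply/negP => /unitrPr[u]; have [p ->] := pi_surj u;
    rewrite -rmorphM -(rmorph1 pi).
  move/eqP; rewrite -subr_eq0 -rmorphB => /eqP/pi_ker[g /(congr1 (meval ev0))].
  rewrite mevalB !mevalM mevalXU meval1 meval0_trinomial mul0r mulr0 sub0r =>
    /eqP.
  by rewrite oppr_eq0 oner_eq0.
have [[p ->] [q ->]] := (pi_surj a, pi_surj b) => pq.
have : pi ('X_z - p * q) = 0 by rewrite rmorphB rmorphM /= pq subrr.
case/pi_ker => g gE.
have := congr1 (meval ev0 \o mderiv z) gE; have := congr1 (meval ev0) gE;
  rewrite /=.
rewrite mevalB !mevalM mevalXU meval0_trinomial mulr0 sub0r => /eqP.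
rewrite oppr_eq0 mulf_eq0.
rewrite mderivB !mderivM mevalB !mevalD !mevalM meval0_trinomial
  meval0_mderiv_trinomial.
rewrite !mulr0 addr0 mderivX mnmE eqxx scale1r.
rewrite mnm_subxx mpolyX0 meval1 => pq0 /eqP; rewrite subr_eq0 => /eqP dpq.
have [p0|p0] := eqVneq p.@[ev0] 0; last by left; apply: factor pq p0.
right; apply: (factor q p); first by rewrite mulrC.
apply: contraNneq (oner_neq0 K) => q0.
by rewrite dpq p0 q0 mul0r mulr0 addr0.
Qed.

(** If g >= 2 divides all exponents of the blocks i and k, then minus the third
    block m equals S_i^g + S_k^g, a product with the factor S_i - zeta S_k
    where zeta^g = -1. The prime z, which divides the block m, divides neither
    S_i - zeta S_k nor its cofactor: on {z = 0} each of these is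
    nonzero at a point of the hypersurface where the other one vanishes. *)
Lemma block_gcd_coprime i k :
  i != k -> coprime (block_gcd c e i) (block_gcd c e k).
Proof.
move=> ik; apply/negPn/negP => ncop.
pose g := gcdn (block_gcd c e i) (block_gcd c e k).
have dvdg t : (c t == i) || (c t == k) -> (g %| e t)%N.
  by move=> h; apply: (dvdn_trans _ (block_gcd_dvd c e t));
    case/orP: h => /eqP ->; rewrite ?dvdn_gcdl ?dvdn_gcdr.
have g_gt0 : (0 < g)%N.
  have [t ct] := c_surj i; rewrite lt0n; apply/eqP => g0.
  by have := dvdg t; rewrite ct eqxx g0 dvd0n => /(_ isT) /eqP et;
    have := e_gt0 t; rewrite et.
have g_ge2 : (2 <= g)%N.
  by rewrite ltn_neqAle g_gt0 eq_sym andbT.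
have [m [mi mk mE]] : exists m : 'I_3, [/\ m != i, m != k &
    forall j, j != i -> j != k -> j = m] := third_index ik.
have [z cz] := c_surj m.
pose S j : {mpoly K[n]} :=
  'X_[[multinom (if c t == j then e t %/ g else 0)%N | t < n]].
have Sg j : (j == i) || (j == k) -> S j ^+ g = 'X_[block c e j].
  move=> ijk; rewrite mpolyXn; congr 'X_[_]; apply/mnmP => t.
  rewrite mulmnE !mnmE; case: eqVneq => [ct|//]; rewrite divnK // dvdg // ct.
  by rewrite ijk.
have [zeta zetaE] := @nth_root_exists K g (-1) g_gt0.
pose C := \sum_(j < g) S i ^+ (g.-1 - j) * (zeta *: S k) ^+ j.
have zdvd : exists u, pi 'X_z * u = pi (S i - zeta *: S k) * pi C.
  exists (- pi 'X_[block c e m - U_(z)]).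
  rewrite mulrN -!rmorphM -subrXX exprZn zetaE scaleN1r opprK !Sg ?eqxx ?orbT
    //.
  rewrite -mpolyXD; have -> : (U_(z) + (block c e m - U_(z)) = block c e m)%MM.
    apply/mnmP => t; rewrite mnmDE mnmBE !mnmE.
    by case: (eqVneq z t) => [<-|_]; rewrite ?cz ?eqxx ?subnKC // add0n subn0.
  apply/eqP; rewrite eq_sym -subr_eq0 opprK -rmorphD; apply/eqP/pi_ker;
    exists 1.
  rewrite mul1r /block_trinomial (bigD1 i) //= (bigD1 k) 1?eq_sym //=.
  rewrite (bigD1 m) ?mi //= big1 ?addr0 ?addrA // => j.
  by case/andP=> /andP[ji jk] jm; rewrite (mE j ji jk) eqxx in jm.
(* All coordinates are 1 except z = 0 and one coordinate of the block i, which
   gives S_i the value s. *)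
have point s : s ^+ g = -1 -> exists v,
    [/\ f.@[v] = 0, v z = 0, (S i).@[v] = s & (S k).@[v] = 1].
  have [x cx] := c_surj i => sg.
  have egx : (0 < e x %/ g)%N by rewrite divn_gt0 // dvdn_leq // dvdg // cx
    eqxx.
  have [r rE] := nth_root_exists s egx.
  pose v t := if t == x then r else if t == z then 0 else 1.
  have xz : x != z by apply: contraNneq mi => xz; rewrite -cz -cx xz.
  have vz : v z = 0 by rewrite /v eq_sym (negPf xz) eqxx.
  have Sk : (S k).@[v] = 1.
    rewrite mevalX big1 // => t _; rewrite mnmE /v;
      have [ct|//] := eqVneq (c t) k.
    have [tx|_] := eqVneq t x; first by move: ik; rewrite -ct tx cx eqxx.
    have [tz|_] := eqVneq t z; last exact: expr1n.
    by move: mk; rewrite -ct tz cz eqxx.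
  have Si : (S i).@[v] = s.
    rewrite mevalX (bigD1 x) //= mnmE cx eqxx /v eqxx rE big1 ?mulr1 // => t tx.
    rewrite mnmE (negPf tx); have [ct|//] := eqVneq (c t) i.
    have [tz|_] := eqVneq t z; last exact: expr1n.
    by move: mi; rewrite -ct tz cz eqxx.
  exists v; split=> //; rewrite raddf_sum (bigD1 i) //= (bigD1 k) 1?eq_sym //=.
  rewrite (bigD1 m) ?mi //= big1 ?addr0 => [|j]; last first.
    by case/andP=> /andP[ji jk] jm; rewrite (mE j ji jk) eqxx in jm.
  rewrite -(Sg i) ?eqxx // -(Sg k) ?eqxx ?orbT // !rmorphXn /= Si Sk sg expr1n.
  rewrite meval_block (bigD1 z) ?cz //= vz expr0n eqn0Ngt e_gt0 mul0r addr0.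
  by rewrite addNr.
have vanish p v : f.@[v] = 0 -> v z = 0 -> (exists u, pi p = pi 'X_z * u) ->
  p.@[v] = 0.
  move=> fv vz [u pu]; apply/eqP/negPn/negP => pv.
  have [q uq] := pi_surj u; have : pi (p - 'X_z * q) != 0.
    apply: (meval_neq0 pi_ker fv);
      by rewrite mevalB mevalM mevalXU vz mul0r subr0.
  by rewrite rmorphB rmorphM /= -uq pu subrr eqxx.
have g0 : g%:R != 0 :> K by rewrite ((pcharf0P K).1 charK0) -lt0n.
have [u uE] := zdvd; case: (ufd_irreducible_prime ufdA (var_irreducible z) uE)
  => zd.
  (* zeta * om is another root of -1: S_i - zeta S_k does not vanish there. *)
  have [om om1 omE] : exists2 om : K, om != 1 & om ^+ g = 1.
    have /closed_rootP[om] : size (\poly_(j < g) (1 : K)) != 1%N.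
      by rewrite size_poly_eq ?oner_neq0 // neq_ltn g_ge2 orbT.
    rewrite rootE horner_poly => /eqP om0; exists om.
      apply: contra_eq_neq om0 => ->.
      rewrite (eq_bigr (fun=> 1)) => [|j _];
        first by rewrite sumr_const card_ord.
      by rewrite expr1n mulr1.
    apply/eqP; rewrite -subr_eq0 subrX1 -[X in _ * X](eq_bigr _ (fun j _ =>
      mul1r _)).
    by rewrite om0 mulr0.
  have [|v [fv vz Si Sk]] := point (zeta * om);
    first by rewrite exprMn zetaE omE mulr1.
  have := vanish _ _ fv vz zd;
    rewrite mevalB mevalZ Si Sk mulr1 -[X in _ - X]mulr1 -mulrBr.
  move/eqP; rewrite mulf_eq0 subr_eq0 (negPf om1) orbF => /eqP zeta0.
  by move/eqP: zetaE; rewrite zeta0 expr0n eqn0Ngt g_gt0 eq_sym oppr_eq0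
    oner_eq0.
(* At S_i = zeta, S_k = 1, all terms of the cofactor equal zeta^(g-1). *)
have [v [fv vz Si Sk]] := point zeta zetaE.
have := vanish _ _ fv vz zd;
  rewrite raddf_sum (eq_bigr (fun=> zeta ^+ g.-1)) => [|j _] /=.
  rewrite sumr_const card_ord -mulr_natl => /eqP;
    rewrite mulf_eq0 (negPf g0) /= expf_eq0.
  case/andP=> _ /eqP zeta0.
  by move/eqP: zetaE; rewrite zeta0 expr0n eqn0Ngt g_gt0 eq_sym oppr_eq0
    oner_eq0.
rewrite mevalM !rmorphXn /= mevalZ Si Sk mulr1 -exprD subnK //.
by have := ltn_ord j; lia.
Qed.

(** A homogenized derivation moves at most one variable x, and f_x * D x = 0
    with f_x <> 0 then shows that it does not move x either. *)
Theorem rigid_of_factorial : has_no_nonzero_lnd A.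
Proof.
move=> D derD nilD a; apply/eqP/negPn/negP => Da.
have /fin_all_exists[v vP] x := modular_weight e_gt0 c_surj x block_gcd_coprime.
have /fin_all_exists[psi psiE] x :
    exists psi : {rmorphism A -> {poly A}}, is_coaction pi (v x) psi.
  by have [N [vN _ _]] := vP x; apply: coaction_exists vN.
have vxx x : (v x x = 1 %[mod e x])%N by have [N []] := vP x.
have vxt t x : t != x -> (e x %| v x t)%N by have [N [_ _ H]] := vP x; apply: H.
have [L [t [derL Lt Ls]]] :=
  lnd_single_variable pi_surj charK0 domA psiE e_ge2 vxx vxt derD nilD Da.
have := der_pi pi derL f; rewrite (pi_block_trinomial pi_ker) linear0 (bigD1 t)
  //=.
rewrite big1 ?addr0 => [/esym/eqP|s /Ls ->]; last by rewrite mulr0.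
by apply/negP/dom_mul_neq0 => //; apply: pi_mderiv_neq0.
Qed.

End FactorialTrinomial.

(** * The coordinate ring of the hypersurface *)

Section PrincipalProjection.
Variables (K : comNzRingType) (S : comAlgType K) (f : S).
Hypothesis f_nonunit : ~ exists g, g * f = 1.

Lemma principal_pi_surj a : exists p, a = principal_pi f_nonunit p.
Proof. by exists (repr a); rewrite /principal_pi reprK. Qed.

Lemma principal_pi_eq0 p : principal_pi f_nonunit p = 0 <-> exists g, p = g * f.
Proof.
rewrite -(rmorph0 (principal_pi f_nonunit)); split=> [/eqP|pf].
  by rewrite /principal_pi -Quotient.idealrBE subr0 => /asboolP.
by apply/eqP; rewrite /principal_pi -Quotient.idealrBE subr0; apply/asboolP.
Qed.

Lemma principal_pi_lrmorphism :
  exists pi : {lrmorphism S -> principal_quot f_nonunit},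
    pi =1 principal_pi f_nonunit.
Proof.
have piZ : scalable (principal_pi f_nonunit).
  by move=> k p; rewrite -mulr_algl rmorphM.
pose HZ := GRing.isScalable.Build K S (principal_quot f_nonunit) *:%R _ piZ.
pose pi : {lrmorphism S -> principal_quot f_nonunit} :=
  HB.pack (principal_pi f_nonunit) HZ.
by exists pi.
Qed.
End PrincipalProjection.

(** The numbering of the pairs (i, j) by a single index turns the double-indexed
    trinomial into the coloured one. *)
Lemma trinomial_blocks (K : closedFieldType) (n : 'I_3 -> nat)
    (l : forall i, 'I_(n i) -> nat) :
  trinomial K l = block_trinomial K (fun t => tag (tagnat.sig t))
    (fun t => l (tag (tagnat.sig t)) (tagged (tagnat.sig t))).
Proof.
apply: eq_bigr => i _; rewrite mpolyXE_id.
rewrite (reindex tagnat.rank) /=; last exact: onW_bij tagnat.rank_bij.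
transitivity (\prod_(i' | i' == i) \prod_(j < n i')
    ('X_(tagnat.Rank i' j) : {mpoly K[\sum_(k < 3) n k]}) ^+ l i' j).
  by rewrite big_pred1_eq.
rewrite sig_big_dep [LHS]big_mkcond; apply: eq_bigr => u _.
rewrite mnmE tagnat.rankK andbT tagnat.rankE.
by case: ifP.
Qed.

Theorem theorem1 (K : closedFieldType) (charK0 : [pchar K] =i pred0)
    (n : 'I_3 -> nat) (l : forall i : 'I_3, 'I_(n i) -> nat)
    (n_gt0 : forall i : 'I_3, (0 < n i)%N)
    (l_gt0 : forall (i : 'I_3) (j : 'I_(n i)), (0 < l i j)%N)
    (no_linear_term :
       forall i : 'I_3, (1 < n i * l i (Ordinal (n_gt0 i)))%N) :
  factorial_hypersurface K n_gt0 l_gt0 ->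
  (rigid_hypersurface K n_gt0 l_gt0 <->
   forall (i : 'I_3) (j : 'I_(n i)), (2 <= l i j)%N).
Proof.
rewrite /factorial_hypersurface /rigid_hypersurface => ufdA.
pose c (t : 'I_(\sum_(i < 3) n i)) := tag (tagnat.sig t).
pose e (t : 'I_(\sum_(i < 3) n i)) :=
  l (tag (tagnat.sig t)) (tagged (tagnat.sig t)).
have [pi piE] := principal_pi_lrmorphism (@trinomial_nonunit K n l n_gt0 l_gt0).
have pi_surj a : exists p, a = pi p.
  by have [p ->] := principal_pi_surj a; exists p; rewrite piE.
have pi_ker p : pi p = 0 <-> exists g, p = g * block_trinomial K c e.
  by rewrite piE -trinomial_blocks; apply: principal_pi_eq0.
have e_gt0 t : (0 < e t)%N by apply: l_gt0.
have sigR i j : tagnat.sig (tagnat.Rank i j) = Tagged (fun i => 'I_(n i)) j.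
  by rewrite -[tagnat.Rank i j]/(tagnat.Rank (tag (Tagged (fun i =>
    'I_(n i)) j)) _)
     -tagnat.rankE tagnat.rankK.
have c_surj i : exists t, c t = i.
  by exists (tagnat.Rank i (Ordinal (n_gt0 i))); rewrite /c sigR.
split=> [rig i j|l2]; last first.
  apply: (@rigid_of_factorial K _ (coordinate_ring K n_gt0 l_gt0) c e c_surj _
    pi) => //.
  by move=> t; apply: l2.
rewrite ltnNge; apply/negP => le1.
have [k ik] : exists k : 'I_3, i != k.
  by exists (if i == 0 then 1 else 0); have [i0|//] := eqVneq i 0; rewrite i0.
have [y cy] := c_surj k.
apply: (@not_rigid_of_exponent1 K _ (coordinate_ring K n_gt0 l_gt0) c e e_gt0 pi
  pi_surj pi_ker charK0 (tagnat.Rank i j) y _ _ rig).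
  by rewrite cy /c sigR.
by apply/eqP; rewrite eqn_leq e_gt0 andbT /e sigR.
Qed.
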